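(* For $n \geq 1$, the only primitive $n$-ary associative operations on $\{0,1\}$ are the unary and binary ones and $\overline{+^{(n)}}$ for $n = 2^k + 1$, $k \in \mathbb{N}$. That is, an $n$-ary associative operation $f$ on $\{0,1\}$ is primitive if and only if $n = 1$, or $n = 2$, or $n = 2^k + 1$ for some $k \in \mathbb{N}$ and $f = \overline{+^{(n)}}$.
   Context: $\mathbb{N}$ denotes the set of nonnegative integers. An operation $f \colon A^n \to A$ on a set $A$ is associative if for all $i, j \in \{0, \dots, n-1\}$ the equality $$f(a_1, \dots, a_i, f(a_{i+1}, \dots, a_{i+n}), a_{i+n+1}, \dots, a_{2n-1}) = f(a_1, \dots, a_j, f(a_{j+1}, \dots, a_{j+n}), a_{j+n+1}, \dots, a_{2n-1})$$ holds for all $a_1, \dots, a_{2n-1} \in A$. In particular, every unary operation is associative. Given an $m$-ary operation $g \colon A^m \to A$ with $m \geq 1$ and $\ell \in \mathbb{N}$, the operation $g_\ell$ of arity $N(\ell) := \ell(m-1)+1$ is defined recursively by $g_0 := \mathrm{id}_A$ and $$g_{\ell+1}(a_1, \dots, a_{N(\ell+1)}) := g_\ell(g(a_1, \dots, a_m), a_{m+1}, \dots, a_{N(\ell+1)})$$ for all $a_1, \dots, a_{N(\ell+1)} \in A$. The operations $g_\ell$ ($\ell \in \mathbb{N}$) are said to be derived (derivable) from $g$. An associative operation $f \colon A^n \to A$ ($n \geq 1$) is primitive if $f$ is not derivable from any associative operation $g \colon A^m \to A$ with $1 \leq m < n$. For $n \geq 2$, $+^{(n)} \colon \{0,1\}^n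 \to \{0,1\}$ is the $n$-ary operation derived from addition modulo $2$, i.e. $+^{(n)}(a_1, \dots, a_n) = a_1 + \dots + a_n \pmod 2$, and $\overline{+^{(n)}}(a_1, \dots, a_n) := +^{(n)}(a_1, \dots, a_n) + 1 \pmod 2$. *)

(* Defs.v *)
From mathcomp Require Import all_boot zify.

Set Implicit Arguments.
Unset Strict Implicit.
Unset Printing Implicit Defensive.

Section Operations.

Variable A : Type.

Definition operation (n : nat) := n.-tuple A -> A.

Section Associativity.

Variable n : nat.
Implicit Types (a : (2 * n - 1).-tuple A) (i : 'I_n).

Lemma size_block a i : size (take n (drop i a)) == n.
Proof.
by rewrite size_take size_drop size_tuple; have := ltn_ord i; case: ifP; lia.
Qed.

(* (a_{i+1}, ..., a_{i+n}) *)
Definition block a i : n.-tuple A := Tuple (size_block a i).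

Lemma size_contract a i x : size (take i a ++ x :: drop (i + n) a) == n.
Proof.
rewrite size_cat /= size_take size_drop size_tuple.
by have := ltn_ord i; case: ifP; lia.
Qed.

(* (a_1, ..., a_i, x, a_{i+n+1}, ..., a_{2n-1}) *)
Definition contract a i x : n.-tuple A := Tuple (size_contract a i x).

Definition associative_op (f : operation n) : Prop :=
  forall i j a, f (contract a i (f (block a i))) = f (contract a j (f (block a j))).

End Associativity.

Definition derived_arity (m l : nat) := l * (m - 1) + 1.

Section Derivation.

Variables (m : nat) (m_gt0 : 0 < m) (g : operation m).

Lemma size_front l (a : (derived_arity m l.+1).-tuple A) : size (take m a) == m.
Proof.
by rewrite size_take size_tuple /derived_arity; case: ifP; nia.
Qed.

Definition front l (a : (derived_arity m l.+1).-tuple A) : m.-tuple A :=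
  Tuple (size_front a).

Lemma size_reduce l (a : (derived_arity m l.+1).-tuple A) x :
  size (x :: drop m a) == derived_arity m l.
Proof. by rewrite /= size_drop size_tuple /derived_arity; nia. Qed.

(* (x, a_{m+1}, ..., a_{N(l+1)}) *)
Definition reduce l (a : (derived_arity m l.+1).-tuple A) x :
  (derived_arity m l).-tuple A := Tuple (size_reduce a x).

Fixpoint derived (l : nat) : operation (derived_arity m l) :=
  match l return operation (derived_arity m l) with
  | 0 => fun a => @thead 0 A a
  | l'.+1 => fun a => @derived l' (reduce a (g (front a)))
  end.

(* The arities n and N(l) are only propositionally equal, hence the cast. *)
Definition derivable n (f : operation n) : Prop :=
  exists (l : nat) (e : n = derived_arity m l),
    forall a : n.-tuple A, f a = @derived l (tcast e a).

End Derivation.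

Definition primitive n (f : operation n) : Prop :=
  associative_op f /\
  forall (m : nat) (m_gt0 : 0 < m) (g : operation m),
    m < n -> associative_op g -> ~ derivable m_gt0 g f.

End Operations.

(* {0,1} is bool (0 = false, 1 = true), so addition modulo 2 is addb. *)
Definition sum_mod2 (n : nat) : operation bool n :=
  fun a => \big[addb/false]_(i < n) tnth a i.

Definition sum_mod2_compl (n : nat) : operation bool n :=
  fun a => addb (sum_mod2 a) true.

(* Main.v *)
(** Associativity of an operation [f] of arity [N + 1] lets every word be reduced
    to a value in any order, so one can compute with words modulo the congruence
    identifying a block of [N + 1] letters with its value under [f].

    Suppose [f] on {0,1} has an idempotent [e], and let [d] be the other element.
    The values of [e^N d] and [d e^N] give four cases: both [e], and [f] is
    iterated from a binary operation with absorbing element [e]; [e] and [d], or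
    [d] and [e], and [f] is the first or the last projection; both [d], and
    [e^N] is neutral, [e] commutes with everything, and [f] is iterated from its
    retract [x e^(N-1) y].  In each case [f] is derived from a binary operation.
    If [f] has no idempotent, 1 is [0^(N+1)], so every word is a power of 0, and
    computing the values of these powers forces [f] to be the complemented sum.

    The complemented sum of arity [l (m - 1) + 1] with [l] odd is derived from
    the one of arity [m], which disposes of [N] with an odd divisor [l > 1].  If
    [N = 2^k] and [f = g_l] with [l > 1], then [l] is even; as [f] changes with
    each argument, so does [g], which is therefore a constant plus the sum, and
    iterating it an even number of times gives the sum, not its complement. *)

Require Import Defs.
From Stdlib Require Import Setoid Morphisms.
From mathcomp Require Import all_boot zify.

Set Implicit Arguments.
Unset Strict Implicit.
Unset Printing Implicit Defensive.

(** * Operations and their iterates as functions on words *)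

Section Sequences.

Variables (A : Type) (x0 : A).

(* Words of length other than [n] get a junk value. *)
Definition seqop n (f : operation A n) (s : seq A) : A :=
  f (insubd (nseq_tuple n x0) s).

Lemma seqop_tuple n (f : operation A n) (t : n.-tuple A) : seqop f t = f t.
Proof. by rewrite /seqop valKd. Qed.

(** Counterpart of [derived] on plain words, where no cast between equal arities is needed. *)
Fixpoint eval n (F : seq A -> A) l (s : seq A) : A :=
  if l is l'.+1 then eval n F l' (F (take n s) :: drop n s) else head x0 s.

Lemma derived_eval m (m_gt0 : 0 < m) (g : operation A m) l
    (a : (derived_arity m l).-tuple A) :
  derived m_gt0 g a = eval m (seqop g) l a.
Proof.
elim: l a => [|l IHl] a /=; first by case/tupleP: a => x a; rewrite theadE.
by rewrite IHl /= -seqop_tuple.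
Qed.

Lemma derivable_eval m (m_gt0 : 0 < m) (g : operation A m) n
    (f : operation A n) :
  derivable m_gt0 g f <->
  exists2 l, n = derived_arity m l &
    forall a : n.-tuple A, f a = eval m (seqop g) l a.
Proof.
split=> [[l [e fE]]|[l e fE]]; exists l => //.
  by move=> a; rewrite fE derived_eval val_tcast.
by exists e => a; rewrite fE derived_eval val_tcast.
Qed.

Definition seq_associative n (F : seq A -> A) : Prop :=
  forall u b v u' b' v', size b = n -> size b' = n ->
  (size u + size v).+1 = n -> (size u' + size v').+1 = n ->
  u ++ b ++ v = u' ++ b' ++ v' -> F (u ++ F b :: v) = F (u' ++ F b' :: v').

Lemma seqop_assoc n (f : operation A n) :
  associative_op f <-> seq_associative n (seqop f).
Proof.
have contractE (i : 'I_n) (a : (2 * n - 1).-tuple A) :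
    f (contract a i (f (block a i)))
    = seqop f (take i a ++ seqop f (take n (drop i a)) :: drop (i + n) a).
  by rewrite -!seqop_tuple.
split=> fA; last first.
  move=> i j a; rewrite !contractE; have := ltn_ord i; have := ltn_ord j.
  move=> lt_j lt_i; apply: fA.
  - by rewrite size_take size_drop size_tuple; case: ifP; lia.
  - by rewrite size_take size_drop size_tuple; case: ifP; lia.
  - by rewrite size_take size_drop size_tuple; case: ifP; lia.
  - by rewrite size_take size_drop size_tuple; case: ifP; lia.
  by rewrite -!(addnC n) -!drop_drop !cat_take_drop.
move=> u b v u' b' v' sb sb' su su' eq_s.
have ltu : size u < n by lia.
have ltu' : size u' < n by lia.
have sa : size (u ++ b ++ v) == 2 * n - 1 by rewrite !size_cat; lia.
have := fA (Ordinal ltu) (Ordinal ltu') (Tuple sa); rewrite !contractE /=.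
rewrite take_size_cat // drop_size_cat // take_size_cat // addnC -drop_drop.
rewrite drop_size_cat // drop_size_cat // eq_s.
rewrite take_size_cat // drop_size_cat // take_size_cat // addnC -drop_drop.
by rewrite drop_size_cat // drop_size_cat.
Qed.

End Sequences.

(** * The congruence on words defined by an associative operation *)

Section Words.

Variables (A : Type) (x0 : A) (N : nat) (N_gt0 : 0 < N) (F : seq A -> A).
Hypothesis F_assoc : seq_associative N.+1 F.

Let ev := eval x0 N.+1 F.

Lemma eval_cat l b s : size b = N.+1 -> ev l.+1 (b ++ s) = ev l (F b :: s).
Proof. by move=> sb; rewrite /ev [LHS]/= take_size_cat ?drop_size_cat. Qed.

(** If [u] contains the first [N.+1] letters, the first step of [eval] does not touch [b] and
    induction applies. Otherwise [b] lies within the first 2N+1 letters, where a single use of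
    associativity exchanges [b] with the initial block. *)
Lemma eval_contract l u b v : size b = N.+1 -> size u + size v = l * N ->
  ev l.+1 (u ++ b ++ v) = ev l (u ++ F b :: v).
Proof.
elim: l u b v => [|l IHl] u b v sb suv.
  have -> : u = [::] by apply: size0nil; lia.
  by rewrite (eval_cat _ _ sb).
have [le_u|lt_u] := leqP N.+1 (size u).
  have su0 : size (take N.+1 u) = N.+1 by rewrite size_takel.
  rewrite -(cat_take_drop N.+1 u) -!catA !eval_cat //.
  apply: (IHl (F (take N.+1 u) :: drop N.+1 u)) => //=.
  by rewrite size_drop; lia.
have sv : size (take (N - size u) v) = N - size u by rewrite size_takel; lia.
rewrite -(cat_take_drop (N - size u) v).
move: (take _ v) (drop _ v) sv => v1 v2 sv1.
have sw : size (u ++ b ++ v1) = N.+1 + N by rewrite !size_cat; lia.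
have -> : u ++ b ++ v1 ++ v2 = (u ++ b ++ v1) ++ v2 by rewrite !catA.
have -> : u ++ F b :: v1 ++ v2 = (u ++ F b :: v1) ++ v2 by rewrite -catA.
rewrite [RHS]eval_cat ?size_cat /=; last by lia.
rewrite -(cat_take_drop N.+1 (u ++ b ++ v1)).
move: (cat_take_drop N.+1 (u ++ b ++ v1)).
have : size (take N.+1 (u ++ b ++ v1)) = N.+1 by rewrite size_takel // sw; lia.
have : size (drop N.+1 (u ++ b ++ v1)) = N by rewrite size_drop sw; lia.
move: (take _ _) (drop _ _) => b0 c0 sc0 sb0 eq_w.
rewrite -catA eval_cat // -cat_cons eval_cat /= ?sc0 //.
congr (ev l (_ :: v2)).
by apply: (F_assoc (u := [::])) => //=; lia.
Qed.

(* A word of length not congruent to 1 modulo [N] has no value, which keeps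
   length side conditions out of the congruence [weq]. *)
Definition value (s : seq A) (x : A) : Prop :=
  exists2 l, size s = (l * N).+1 & ev l s = x.

Definition weq (u v : seq A) : Prop :=
  forall p q x, value (p ++ u ++ q) x <-> value (p ++ v ++ q) x.

Local Notation "u ~ v" := (weq u v) (at level 70).

#[local] Instance weq_equivalence : Equivalence weq.
Proof.
split=> [u|u v E|u v w E1 E2] p q x //; first by rewrite (E p q x).
by rewrite (E1 p q x) (E2 p q x).
Qed.

#[local] Instance cat_weq : Proper (weq ==> weq ==> weq) cat.
Proof.
move=> u u' Eu v v' Ev p q x.
by rewrite -!catA (Eu p (v ++ q) x) !(catA p) (Ev (p ++ u') q x).
Qed.

#[local] Instance cons_weq : Proper (eq ==> weq ==> weq) cons.
Proof. by move=> x _ <- u v E; rewrite -(cat1s x u) -(cat1s x v) E. Qed.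

#[local] Instance rcons_weq : Proper (weq ==> eq ==> weq) rcons.
Proof. by move=> u v E x _ <-; rewrite -!cats1 E. Qed.

Lemma weq_op b : size b = N.+1 -> b ~ [:: F b].
Proof.
move=> sb p q x; split=> -[l]; rewrite !size_cat /= ?sb => sl <-.
  case: l sl => [|l] sl; first by lia.
  by exists l; rewrite ?size_cat /= ?eval_contract //; lia.
by exists l.+1; rewrite ?size_cat /= ?eval_contract //; lia.
Qed.

Lemma weq_opE b x : size b = N.+1 -> F b = x -> b ~ [:: x].
Proof. by move=> sb <-; apply: weq_op. Qed.

Lemma weq1 x y : [:: x] ~ [:: y] -> x = y.
Proof.
move=> /(_ [::] [::] x) [E _]; case: E; first by exists 0.
by case=> [|l] //= [sl]; lia.
Qed.

Lemma weq_opP b x : size b = N.+1 -> b ~ [:: x] -> F b = x.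
Proof. by move=> sb E; apply: weq1; rewrite -weq_op. Qed.

(** * Computing with words in the presence of an idempotent *)

Section Idempotent.

Variables (e : A) (e_idem : F (nseq N.+1 e) = e).

Lemma weq_idem : nseq N.+1 e ~ [:: e].
Proof. by rewrite (weq_op (size_nseq _ _)) e_idem. Qed.

(** Expanding the idempotent, e a ~ e^(N+1) a = e (e^N a) ~ e e, so the letters after [e] turn into
    [e] one at a time. *)
Lemma idem_absorb_right u : (forall a, F (rcons (nseq N e) a) = e) ->
  e :: u ~ nseq (size u).+1 e.
Proof.
move=> Fe; elim: u => [|a u IHu] //=.
have E : rcons (nseq N e) a ~ [:: e].
  by apply: weq_opE; rewrite // size_rcons size_nseq.
have eq_a : [:: e; a] ~ [:: e; e].
  transitivity (nseq N.+1 e ++ [:: a]); first by rewrite weq_idem.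
  by rewrite cats1 /= E.
by rewrite -[e :: a :: u]/([:: e; a] ++ u) eq_a /= IHu.
Qed.

Lemma idem_absorb_left u : (forall a, F (a :: nseq N e) = e) ->
  rcons u e ~ nseq (size u).+1 e.
Proof.
move=> Fe; elim/last_ind: u => [|u a IHu] //=.
have E : a :: nseq N e ~ [:: e] by apply: weq_opE; rewrite //= size_nseq.
have eq_a : [:: a; e] ~ [:: e; e].
  transitivity (a :: nseq N.+1 e); first by rewrite weq_idem.
  by rewrite -[N.+1]addn1 nseqD -cat_cons E.
transitivity (rcons (rcons u e) e); first by rewrite -!cats1 -!catA /= eq_a.
by rewrite IHu size_rcons -cats1 -(nseqD _ 1) addn1.
Qed.

Lemma idem_zero u v : (forall a, F (rcons (nseq N e) a) = e) ->
  (forall a, F (a :: nseq N e) = e) ->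
  size (u ++ e :: v) = N.+1 -> F (u ++ e :: v) = e.
Proof.
move=> Fl Fr suv; apply: weq_opP => //; rewrite -cat_rcons.
rewrite idem_absorb_left // -addn1 nseqD -catA [_ ++ v]/= idem_absorb_right //.
by rewrite -nseqD -weq_idem -suv size_cat.
Qed.

(** As e^N z ~ z, the word u z may be replaced by u e^N z; there [u] is absorbed, which leaves
    e^(2N) z ~ z. *)
Lemma idem_proj_last u z : (forall a, F (rcons (nseq N e) a) = a) ->
  (forall a, F (a :: nseq N e) = e) -> size u = N -> F (rcons u z) = z.
Proof.
move=> Fl Fr su; apply: weq_opP; first by rewrite size_rcons su.
have ez : nseq N e ++ [:: z] ~ [:: z].
  by rewrite cats1; apply: weq_opE; rewrite ?size_rcons ?size_nseq.
rewrite -cats1 -[in X in X ~ _]ez.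
have -> : u ++ nseq N e ++ [:: z] = rcons u e ++ nseq N.-1 e ++ [:: z].
  by rewrite -{1}(prednK N_gt0) cat_rcons.
rewrite idem_absorb_left // catA -nseqD.
have -> : (size u).+1 + N.-1 = N + N by lia.
by rewrite nseqD -catA ez.
Qed.

Hypothesis e_right : forall a, F (a :: nseq N e) = a.

Lemma idem_cons a j u : a :: nseq (j * N) e ++ u ~ a :: u.
Proof.
elim: j => [|j IHj] //.
have E : a :: nseq N e ~ [:: a] by apply: weq_opE; rewrite //= size_nseq.
by rewrite mulSn nseqD -catA -cat_cons E.
Qed.

Lemma idem_proj_first x s : (forall a, F (rcons (nseq N e) a) = e) ->
  size s = N -> F (x :: s) = x.
Proof.
move=> Fl ss; apply: weq_opP; first by rewrite /= ss.
rewrite -(idem_cons x 1) mul1n.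
have -> : nseq N e ++ s = nseq N.-1 e ++ e :: s.
  by rewrite -{1}(prednK N_gt0) -[N.-1.+1]addn1 nseqD -catA.
rewrite idem_absorb_right // -nseqD.
have -> : N.-1 + (size s).+1 = 2 * N by lia.
by rewrite -[nseq _ e]cats0 idem_cons.
Qed.

Hypothesis e_comm : forall a, [:: a; e] ~ [:: e; a].

Lemma nseq_comm k u : nseq k e ++ u ~ u ++ nseq k e.
Proof.
elim: u k => [|a u IHu] k; first by rewrite cats0.
have E : nseq k e ++ [:: a] ~ a :: nseq k e.
  elim: k => [|k IHk] //=; rewrite IHk.
  by rewrite -[[:: e, a & _]]/([:: e; a] ++ _) -e_comm.
by rewrite -(cat1s a) catA E cat_cons IHu.
Qed.

Definition retract x y := F (x :: rcons (nseq N.-1 e) y).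

Lemma retract_weq x y : [:: retract x y] ~ x :: rcons (nseq N.-1 e) y.
Proof. by rewrite -weq_op //= size_rcons size_nseq; lia. Qed.

(** Both sides are values of the same word x e^(N-1) y e^(N-1) z. *)
Lemma retract_assoc : associative retract.
Proof.
move=> x y z; apply: weq1.
rewrite !retract_weq -[_ :: rcons _ z]/([:: _] ++ _) retract_weq -cats1.
by rewrite retract_weq -!cats1 /= -catA.
Qed.

Lemma foldl_retract x s :
  [:: foldl retract x s] ~ x :: s ++ nseq (size s * N.-1) e.
Proof.
elim: s x => [|y s IHs] x //=.
rewrite IHs -[retract x y :: _]/([:: retract x y] ++ _) retract_weq mulSn nseqD.
rewrite cat_cons cat_rcons nseq_comm /=.
by rewrite -!catA -!nseqD addnC.
Qed.

(** The N(N-1) padding letters [e] gathered at the end can be moved next to [x], where they vanish N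
    at a time. *)
Lemma foldl_retractE x s : size s = N -> foldl retract x s = F (x :: s).
Proof.
move=> ss; apply/esym/weq_opP; first by rewrite /= ss.
by rewrite foldl_retract -nseq_comm ss mulnC idem_cons.
Qed.

End Idempotent.
End Words.

(** * Iterating a binary operation *)

Section Binary.

Variable A : Type.

Definition binop (h : A -> A -> A) : operation A 2 :=
  fun t => h (thead t) (thead (behead_tuple t)).

Lemma seqop_binop x0 h x y : seqop x0 (binop h) [:: x; y] = h x y.
Proof.
by rewrite -[[:: x; y]]/(tval [tuple x; y]) seqop_tuple /binop !theadE.
Qed.

Lemma binop_assoc (x0 : A) h : associative h -> associative_op (binop h).
Proof.
move=> hA; apply/(seqop_assoc x0).
have E u b v : size b = 2 -> (size u + size v).+1 = 2 ->
    exists x y z, u ++ b ++ v = [:: x; y; z] /\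
      seqop x0 (binop h) (u ++ seqop x0 (binop h) b :: v) = h x (h y z).
  case: b => [|x [|y []]] // _; case: u => [|z [|//]]; case: v => [|t []] // _.
    by exists x, y, t; rewrite /= !seqop_binop hA.
  by exists z, x, y; rewrite /= !seqop_binop.
move=> u b v u' b' v' sb sb' su su'.
have [x [y [z [-> ->]]]] := E u b v sb su.
have [x' [y' [z' [-> ->]]]] := E u' b' v' sb' su'.
by case=> -> -> ->.
Qed.

Lemma eval_binop x0 h x s :
  eval x0 2 (seqop x0 (binop h)) (size s) (x :: s) = foldl h x s.
Proof.
elim: s x => [|y s IHs] x //=.
by rewrite take0 drop0 seqop_binop IHs.
Qed.

Lemma derivable_binop x0 h n (f : operation A n) : 0 < n ->
  (forall x s, size (x :: s) = n -> seqop x0 f (x :: s) = foldl h x s) ->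
  derivable (isT : 0 < 2) (binop h) f.
Proof.
move=> n_gt0 fE; apply/(derivable_eval x0).
exists n.-1 => [|a]; first by rewrite /derived_arity; lia.
rewrite -(seqop_tuple x0); case: a => -[|x s] /= /eqP sa; first by lia.
by rewrite fE // -sa /= eval_binop.
Qed.

End Binary.

(** * Associative operations on a two-element set *)

Section Boolean.

Lemma eq_or_negb (a b : bool) : a = b \/ a = ~~ b.
Proof. by case: a b => [] []; [left|right|right|left]. Qed.

Variables (N : nat) (N_gt0 : 0 < N) (F : seq bool -> bool).
Hypothesis F_assoc : seq_associative N.+1 F.

Local Notation "u ~ v" := (weq false N F u v) (at level 70).

#[local] Existing Instances weq_equivalence cat_weq cons_weq rcons_weq.

Section Idempotent.

Variables (e : bool) (e_idem : F (nseq N.+1 e) = e).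

Lemma zero_foldl :
  (forall a, F (rcons (nseq N e) a) = e) -> (forall a, F (a :: nseq N e) = e) ->
  exists2 h, associative h & forall x s, size s = N -> F (x :: s) = foldl h x s.
Proof.
move=> Fl Fr.
(* An operation with zero [e] is determined by its value at the pair of other elements; the constant
   word of [~~ e] dictates that value. *)
pose h x y := if (x == e) || (y == e) then e else F (nseq N.+1 (~~ e)).
have he s x : e \in x :: s -> foldl h x s = e.
  elim: s x => [|y s IHs] x /=; first by rewrite inE => /eqP.
  rewrite !inE orbA /h => e_s; apply: IHs; rewrite inE.
  move: e_s; rewrite (eq_sym x) (eq_sym y).
  by case: ifP => [_ _|_ /= ->]; rewrite ?eqxx ?orbT.
exists h => [x y z|x s ss].
  by rewrite /h; move: (F _) => c; case: (e) x y z c => [] [] [] [] [].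
have sxs : size (x :: s) = N.+1 by rewrite /= ss.
have [e_s|] := boolP (e \in x :: s).
  rewrite he //; move: sxs; case/splitPr: e_s => u v.
  exact: (idem_zero false).
move=> e_s; have {e_s sxs} xsd : x :: s = nseq N.+1 (~~ e).
  rewrite -sxs; apply/all_pred1P/allP => y ys /=.
  by apply: contraR e_s; case: (e) (y) ys => [] [].
rewrite xsd; case: xsd => -> ->.
have hd : h (~~ e) (~~ e) = F (nseq N.+1 (~~ e)) by rewrite /h orbb; case: (e).
(* Either the first step of the fold yields [e], which then persists, or [~~ e] is idempotent for
   [h] and the fold stays at [~~ e]. *)
have [Fe|Fd] := eq_or_negb (F (nseq N.+1 (~~ e))) e.
  have -> : foldl h (~~ e) (nseq N (~~ e)) = foldl h e (nseq N.-1 (~~ e)).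
    by rewrite -{1}(prednK N_gt0) /= hd Fe.
  by rewrite Fe he // inE eqxx.
by rewrite Fd; elim: (N) => //= k IHk; rewrite hd Fd.
Qed.

(** Once [e] is known to commute with the other element, the retract is the required binary
    operation. *)
Lemma neutral_foldl :
  (forall a, F (rcons (nseq N e) a) = a) -> (forall a, F (a :: nseq N e) = a) ->
  exists2 h, associative h & forall x s, size s = N -> F (x :: s) = foldl h x s.
Proof.
move=> Fl Fr; have e_cons := idem_cons false N_gt0 F_assoc Fr.
have e_op x : x :: nseq N e ~ [:: x].
  by have := e_cons x 1 [::]; rewrite mul1n cats0.
have e_op' x : nseq N e ++ [:: x] ~ [:: x].
  by rewrite cats1; apply: weq_opE; rewrite ?size_rcons ?size_nseq.
(* Were the value [e], multiplying by [e^(N-1)] on the left and [e] on the right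
   would give [~~ e = e^N (~~ e) e^N = e^(N+1) = e]. *)
have ed : [:: e, ~~ e & nseq N.-1 e] ~ [:: ~~ e].
  have sw : size [:: e, ~~ e & nseq N.-1 e] = N.+1 by rewrite /= size_nseq; lia.
  have [we|wd] := eq_or_negb (F [:: e, ~~ e & nseq N.-1 e]) e.
  + suff de : [:: ~~ e] ~ [:: e] by have := weq1 N_gt0 de; case: (e).
    transitivity (nseq N e ++ ~~ e :: nseq N e).
      by rewrite (e_op (~~ e)) (e_op' (~~ e)).
    have eN : nseq N e = nseq N.-1 e ++ [:: e].
      by rewrite -(nseqD _ 1) addn1 prednK.
    have -> : nseq N e ++ ~~ e :: nseq N e =
        nseq N.-1 e ++ [:: e, ~~ e & nseq N.-1 e] ++ [:: e].
      by rewrite eN -catA.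
    have E : [:: e, ~~ e & nseq N.-1 e] ~ [:: e] by apply: weq_opE.
    by rewrite E catA -eN -(nseqD _ 1) addn1 weq_idem.
  + exact: weq_opE.
have e_comm : forall a, [:: a; e] ~ [:: e; a].
  move=> a; have [->|->] // := eq_or_negb a e.
  (* With d the other element, d e ~ (e d e^(N-1)) e = e (d e^N) ~ e d. *)
  transitivity ([:: e, ~~ e & nseq N.-1 e] ++ [:: e]); first by rewrite ed.
  have -> : [:: e, ~~ e & nseq N.-1 e] ++ [:: e] = e :: ~~ e :: nseq N e.
    by rewrite /= -(nseqD _ 1) addn1 prednK.
  by rewrite e_op.
exists (retract N F e); first exact: (retract_assoc false).
by move=> x s ss; rewrite (foldl_retractE N_gt0 F_assoc Fr e_comm).
Qed.

End Idempotent.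

(** Replacing each 1 by 0^(N+1) lengthens a word by N, so a word of N+1 letters with c ones becomes
    0^((c+1)N+1). From exponent N+1 on, the values of these powers alternate 1, 0, 1, and so on. *)
Lemma fixpoint_free_parity s : (forall a, F (nseq N.+1 a) = ~~ a) ->
  size s = N.+1 -> F s = ~~ odd (count id s).
Proof.
move=> FN ss; pose pow j := nseq (j * N).+1 false.
have nseq_pow j : nseq N false ++ pow j = pow j.+1.
  by rewrite /pow mulSn -nseqD addnS.
have s_pow u : size u = N.+1 -> u ~ pow (count id u).+1.
  rewrite /pow mulSn -addSn => <-; elim: u => [|a t IHt] //=.
  rewrite {1}IHt; case: a => /=; last by rewrite add0n.
  have E : [:: true] ~ nseq N.+1 false.
    by symmetry; apply: weq_opE; rewrite ?size_nseq ?FN.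
  rewrite -[true :: _]/([:: true] ++ _) E -nseqD.
  by have -> : N.+1 + (size t + count id t * N) =
               (size t + (1 + count id t) * N).+1 by lia.
have pow1 : pow 1 ~ [:: true].
  by rewrite /pow mul1n; apply: weq_opE; rewrite ?size_nseq ?FN.
(* If 0^(2N+1) had value 1, then by induction so would all higher powers, and hence the word
   1^(N+1), whose value is 0. *)
have [pow2|pow2] : pow 2 ~ [:: true] \/ pow 2 ~ [:: false].
    have E : pow 2 ~ [:: F (true :: nseq N false)].
      rewrite -(weq_op false N_gt0 F_assoc); last by rewrite /= size_nseq.
      rewrite -[true :: _]/([:: true] ++ _) -pow1 -nseqD.
      by rewrite /pow mulSn mul1n addSn.
    by case: (F _) E; [left|right].
  have powS j : pow j.+1 ~ [:: true].
    elim: j => // j IHj.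
    by rewrite -nseq_pow IHj -pow1 nseq_pow pow2 pow1.
  have : F (nseq N.+1 true) = true.
    apply: (weq_opP (x0 := false) N_gt0 F_assoc); first by rewrite size_nseq.
    by rewrite (s_pow _ (size_nseq _ _)) powS.
  by rewrite FN.
apply: (weq_opP (x0 := false) N_gt0 F_assoc) => //.
transitivity (pow (count id s).+1); first exact: s_pow.
elim: (count id s) => [|j IHj]; first exact: pow1.
rewrite -nseq_pow IHj /=; case: (odd j) => /=; last first.
  by rewrite -pow1 nseq_pow.
by rewrite -[[:: false]]/(pow 0) nseq_pow.
Qed.

Lemma bool_assoc_cases :
  (exists2 h, associative h &
     forall x s, size s = N -> F (x :: s) = foldl h x s) \/
  (forall s, size s = N.+1 -> F s = ~~ odd (count id s)).
Proof.
suff idem e : F (nseq N.+1 e) = e ->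
    exists2 h, associative h &
      forall x s, size s = N -> F (x :: s) = foldl h x s.
  have [/idem|Ft] := eq_or_negb (F (nseq N.+1 true)) true; first by left.
  have [/idem|Ff] := eq_or_negb (F (nseq N.+1 false)) false; first by left.
  by right=> s; apply: fixpoint_free_parity => -[].
move=> e_idem.
have Fl : F (rcons (nseq N e) e) = e by rewrite -cats1 -(nseqD _ 1) addn1.
have [Fld|Fld] := eq_or_negb (F (rcons (nseq N e) (~~ e))) e;
have [Frd|Frd] := eq_or_negb (F (~~ e :: nseq N e)) e.
- apply: (zero_foldl e_idem) => a; by have [->|->] := eq_or_negb a e.
- exists (fun x _ => x) => // x s ss.
  rewrite (idem_proj_first false N_gt0 F_assoc e_idem) //.
  + by elim: (s).
  + by move=> a; have [->|->] := eq_or_negb a e.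
  + by move=> a; have [->|->] := eq_or_negb a e.
- exists (fun _ y => y) => // x s ss.
  have -> : foldl (fun _ y => y) x s = last x s by elim: (s) (x) => /=.
  rewrite lastI (idem_proj_last false N_gt0 F_assoc e_idem) ?size_belast //.
  + by move=> a; have [->|->] := eq_or_negb a e.
  + by move=> a; have [->|->] := eq_or_negb a e.
- apply: (neutral_foldl e_idem) => a; by have [->|->] := eq_or_negb a e.
Qed.

End Boolean.

(** * Parity and the complemented sum *)

Section Parity.

Variable m : nat.

Lemma sum_mod2E n (a : n.-tuple bool) : sum_mod2 a = odd (count id a).
Proof.
rewrite /sum_mod2 -(big_tuple _ _ a xpredT id).
by elim: (tval a) => [|b s IHs]; rewrite ?big_nil ?big_cons //= oddD IHs oddb.
Qed.

(** The inner and outer complements cancel, so a nested application gives the parity of the whole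
    word, wherever the block sits. *)
Lemma sum_mod2_compl_assoc : associative_op (@sum_mod2_compl m).
Proof.
apply/(seqop_assoc false).
pose F := seqop false (@sum_mod2_compl m).
have E s : size s = m -> F s = ~~ odd (count id s).
  move=> /eqP ss; rewrite /F -[s]/(tval (Tuple ss)) seqop_tuple.
  by rewrite /sum_mod2_compl sum_mod2E addbT.
rewrite -/F => u b v u' b' v' sb sb' su su' eq_s.
have {}E u1 b1 v1 : size b1 = m -> (size u1 + size v1).+1 = m ->
    F (u1 ++ F b1 :: v1) = odd (count id (u1 ++ b1 ++ v1)).
  move=> sb1 su1; rewrite !E ?size_cat //=; last by lia.
  by rewrite !count_cat /= !oddD oddb; do 3!case: (odd _).
by rewrite !E // eq_s.
Qed.

Variable (g : seq bool -> bool) (c : bool).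

(** Each of the [l] applications of [g] preserves the parity up to adding [c] once. *)
Lemma eval_affine l s : 0 < m ->
  (forall s, size s = m -> g s = c (+) odd (count id s)) ->
  size s = derived_arity m l ->
  eval false m g l s = (odd l && c) (+) odd (count id s).
Proof.
rewrite /derived_arity => m_gt0 gE.
elim: l s => [|l IHl] s ss /=; first by case: s ss => [|b []] //=; case: b.
rewrite IHl /= ?size_drop; last by nia.
rewrite gE ?size_takel //; last by nia.
rewrite -{3}(cat_take_drop m s) count_cat !oddD oddb.
by case: (odd l); case: c; do 2!case: (odd _).
Qed.

End Parity.

(** With only two values available, separating the parities forces [g] to be constant on each of
    them; [c] is its value at the zero word. *)
Lemma affine_of_parity m (g : seq bool -> bool) : 0 < m ->
  (forall s t, size s = m -> size t = m ->
     g s = g t -> odd (count id s) = odd (count id t)) ->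
  exists c, forall s, size s = m -> g s = c (+) odd (count id s).
Proof.
move=> m_gt0 g_inj; pose z := nseq m false; pose z1 := true :: nseq m.-1 false.
have [sz sz1] : size z = m /\ size z1 = m by rewrite /= !size_nseq; lia.
have oz : odd (count id z) = false by rewrite count_nseq mul0n.
have oz1 : odd (count id z1) by rewrite /= count_nseq.
have gz1 : g z1 != g z.
  by apply/eqP => /(g_inj _ _ sz1 sz); rewrite oz1 oz.
exists (g z) => s ss; case os: (odd _).
  have : g s != g z by apply/eqP => /(g_inj _ _ ss sz); rewrite os oz.
  by case: (g s) (g z) => [] [].
have : g s != g z1 by apply/eqP => /(g_inj _ _ ss sz1); rewrite os oz1.
by move: gz1; case: (g s) (g z) (g z1) => [] [] [].
Qed.

Lemma sum_mod2_compl_derivable m l n (m_gt0 : 0 < m) (f : operation bool n) :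
  odd l -> n = derived_arity m l -> f =1 @sum_mod2_compl n ->
  derivable m_gt0 (@sum_mod2_compl m) f.
Proof.
move=> l_odd nE fE; apply/(derivable_eval false); exists l => // a.
rewrite fE /sum_mod2_compl sum_mod2E (@eval_affine m _ true) ?size_tuple //.
  by rewrite l_odd addbC.
move=> s /eqP ss; rewrite -[s]/(tval (Tuple ss)) seqop_tuple /sum_mod2_compl.
by rewrite sum_mod2E addbC.
Qed.

Lemma sum_mod2_compl_underivable k m n (m_gt0 : 0 < m) (g : operation bool m)
    (f : operation bool n) :
  n = 2 ^ k + 1 -> m < n -> f =1 @sum_mod2_compl n -> ~ derivable m_gt0 g f.
Proof.
move=> nE lt_mn fE /(derivable_eval false) [l nE' f_der].
have lm : l * (m - 1) = 2 ^ k by move: nE'; rewrite /derived_arity; lia.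
have fs s : size s = n ->
    eval false m (seqop false g) l s = ~~ odd (count id s).
  move=> /eqP ss; rewrite -[s]/(tval (Tuple ss)) -f_der fE /sum_mod2_compl.
  by rewrite sum_mod2E addbT.
(* As a divisor of 2^k, [l] is a power of 2, and [l] = 1 would give [m] = [n]. *)
have l_even : odd l = false.
  have /(dvdn_pfactor _ _ (isT : prime 2)) [j _ lE] : l %| 2 ^ k.
    by rewrite -lm dvdn_mulr.
  case: j lE => [|j] lE; last by rewrite lE oddX.
  by move: lE lm nE lt_mn; rewrite expn0 => ->; lia.
have l_gt0 : 0 < l by have := expn_gt0 2 k; rewrite -lm; case: (l).
have [c gE] : exists c, forall s, size s = m ->
    seqop false g s = c (+) odd (count id s).
  apply: affine_of_parity => // s t ss st gst.
  (* Padding with zeros keeps the parity, and the first step of [eval] sees the first [m] letters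
     only through [g]. *)
  pose w := nseq (n - m) false.
  have w0 u : odd (count id (u ++ w)) = odd (count id u).
    by rewrite count_cat count_nseq mul0n addn0.
  apply: negb_inj; rewrite -(w0 s) -(w0 t) -!fs ?size_cat ?size_nseq; try lia.
  case: (l) l_gt0 => // l' _ /=.
  by rewrite (take_size_cat _ ss) (drop_size_cat _ ss) (take_size_cat _ st)
             (drop_size_cat _ st) gst.
(* On the zero word an even iterate of [g] gives 0, while the complemented sum gives 1. *)
have := fs (nseq n false) (size_nseq _ _).
rewrite (eval_affine m_gt0 gE) ?size_nseq // l_even addFb.
by rewrite count_nseq mul0n.
Qed.

(** * Classification of the primitive operations *)

Theorem proposition4p3 (n : nat) (n_gt0 : 0 < n) (f : operation bool n)
    (f_assoc : associative_op f) :
  primitive f <->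
  n = 1 \/ n = 2 \/ (exists k : nat, n = 2 ^ k + 1 /\ f =1 @sum_mod2_compl n).
Proof.
split=> [[_ f_prim]|f_cases]; last first.
  split=> // m m_gt0 g lt_mn _.
  case: f_cases => [n1|[n2|[k [nE fE]]]]; first by lia.
    (* Here [m] = 1, and everything derived from a unary operation is unary. *)
    by move=> /(derivable_eval false) [l]; rewrite /derived_arity; nia.
  exact: sum_mod2_compl_underivable nE lt_mn fE.
have [n_le2|n_gt2] := leqP n 2; first by lia.
right; right.
case: n => // N in n_gt0 f f_assoc f_prim n_gt2 *.
have N_gt0 : 0 < N by lia.
have /(seqop_assoc false) F_assoc := f_assoc.
have [[h hA fh]|f_parity] := bool_assoc_cases N_gt0 F_assoc.
  case: (f_prim 2 isT (binop h) n_gt2 (binop_assoc false hA)).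
  by apply: (derivable_binop (x0 := false)) => // x s [/fh].
have fE : f =1 @sum_mod2_compl N.+1.
  move=> a; rewrite /sum_mod2_compl sum_mod2E addbT.
  by rewrite -(seqop_tuple false) f_parity ?size_tuple.
(* Write N as 2^k times its odd part [l]. If [l] > 1, the complemented sum of the smaller arity 2^k
   + 1 derives [f], against primitivity. *)
have [l l_odd NE] := pfactor_coprime (isT : prime 2) N_gt0.
rewrite coprime2n in l_odd; exists (logn 2 N).
have [l1|l_neq1] := eqVneq l 1; first by split=> //; rewrite {1}NE l1; lia.
set m := 2 ^ logn 2 N + 1; have m_gt0 : 0 < m by rewrite /m; lia.
have l_gt1 : 1 < l by case: l l_odd l_neq1 {NE} => [|[]].
have m_gt1 : 0 < 2 ^ logn 2 N by rewrite expn_gt0.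
case: (f_prim m m_gt0 (@sum_mod2_compl m)); first by rewrite /m; nia.
  exact: sum_mod2_compl_assoc.
by apply: sum_mod2_compl_derivable l_odd _ fE; rewrite /derived_arity /m; lia.
Qed.
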